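(* Let $(\mathcal{S}^x,H)$ be a finite elation generalized quadrangle of order $(t^2,t)$ satisfying property ( * ). Then $(\mathcal{S}^x,H)$ is a skew translation generalized quadrangle. In particular, $x$ is a regular point.
   Context: A finite generalized quadrangle (GQ) of order $(s,t)$: every line has $s+1$ points, every point is on $t+1$ lines, two points are on at most one common line, and for each point $p$ not on a line $L$ there is a unique point of $L$ collinear with $p$. An elation generalized quadrangle (EGQ) $(\mathcal{S}^x,H)$: $H\le\mathrm{Aut}(\mathcal{S})$ fixes every line through $x$ and acts sharply transitively on the points not collinear with $x$. A symmetry about $x$ is an automorphism fixing every point collinear with $x$; the EGQ is a skew translation generalized quadrangle if $H$ contains a subgroup of $t$ symmetries about $x$. Property ( * ): whenever a point $y\neq x$ collinear with $x$ is fixed by some element $h\in H$, then $h$ fixes every point of the line $xy$. For a set $X$ of points, $X^\perp$ is the set of points collinear with every element of $X$ (a point is collinear with itself). A point $x$ is regular if for every point $y$ not collinear with $x$ one has $|\{x,y\}^{\perp\perp}|=t+1$. *)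

(* Defs.v *)
From mathcomp Require Import all_boot all_fingroup.
Set Implicit Arguments. Unset Strict Implicit. Unset Printing Implicit Defensive.

Section GQ.
Variables (P L : finType) (I : P -> L -> bool).

(* p and q lie on a common line (a point is collinear with itself). *)
Definition collinear (p q : P) : bool := [exists l, I p l && I q l].

Definition perp (X : {set P}) : {set P} :=
  [set z | [forall y in X, collinear y z]].

Definition is_GQ (s t : nat) : Prop :=
  [/\ forall l, #|[set p | I p l]| = s.+1,
      forall p, #|[set l | I p l]| = t.+1,
      forall p q l1 l2, p != q -> I p l1 -> I q l1 -> I p l2 -> I q l2 -> l1 = l2
    & forall p l, ~~ I p l -> exists! q, I q l && collinear p q].

Definition is_collineation (g : {perm P}) : Prop :=
  exists h : {perm L}, forall p l, I (g p) (h l) = I p l.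

Definition is_EGQ (x : P) (H : {group {perm P}}) : Prop :=
  [/\ forall g, g \in H -> is_collineation g,
      (* every element of H fixes every line through x *)
      forall g l p, g \in H -> I x l -> I p l -> I (g p) l
    &
      forall y z, ~~ collinear x y -> ~~ collinear x z ->
        exists! g, g \in H /\ g y = z].

Definition symmetry_about (x : P) (g : {perm P}) : Prop :=
  is_collineation g /\ forall p, collinear x p -> g p = p.

Definition is_STGQ (t : nat) (x : P) (H : {group {perm P}}) : Prop :=
  exists S : {group {perm P}},
    [/\ S \subset H, #|S| = t & forall g, g \in S -> symmetry_about x g].

Definition propertyStar (x : P) (H : {group {perm P}}) : Prop :=
  forall y g, y != x -> collinear x y -> g \in H -> g y = y ->
    forall l, I x l -> I y l -> forall p, I p l -> g p = p.

Definition regular_point (t : nat) (x : P) : Prop :=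
  forall y, ~~ collinear x y -> #|perp (perp [set x; y])| = t.+1.

End GQ.

(* Main.v *)
(** Let l1, l2 be two lines through x, and z1, z2 points on them other than x.
    Sharp transitivity shows that the stabilizer S of z1 and z2 in H is regular
    on {z1, z2}^perp minus x, hence has order t, and (star) makes S fix l1 and l2
    pointwise.  The point is that a nontrivial g in S fixes every point collinear
    with x.  If g moved a point w, take a line u <> xw through w.  Then u, g u and
    l1 are pairwise disjoint, so, the order being (t^2, t), they have t + 1 > 1
    common transversals.  One other than the line xw is fixed by g, because its
    point p on l1 is fixed and the projection of p to u goes to its projection to
    g u; but a fixed transversal forces a fixed point not collinear with x.
    Finally {x, y}^perpperp = {z1, z2}^perp when z1, z2 are the projections of y
    to l1, l2. *)

Require Import Defs.
From mathcomp Require Import all_boot all_fingroup.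
From mathcomp Require Import zify.
Set Implicit Arguments. Unset Strict Implicit. Unset Printing Implicit Defensive.

Lemma exists_other (T : finType) (A : {set T}) a :
  1 < #|A| -> exists2 b, b \in A & b != a.
Proof.
move=> A_gt1; have /card_gt0P[b] : 0 < #|A :\ a|.
  by move: A_gt1; rewrite (cardsD1 a A); case: (a \in A) => //; apply: ltnW.
by rewrite in_setD1 => /andP[nba bA]; exists b.
Qed.

(** * Incidence, projections and perps in a generalized quadrangle *)

Section GeneralizedQuadrangle.
Variables (P L : finType) (I : P -> L -> bool) (s t : nat).
Hypothesis gq : is_GQ I s t.
Notation col := (collinear I).

Let card_line l : #|[set p | I p l]| = s.+1. Proof. by case: gq. Qed.
Let card_pencil p : #|[set l | I p l]| = t.+1. Proof. by case: gq. Qed.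

Lemma line_unique p q l1 l2 :
  p != q -> I p l1 -> I q l1 -> I p l2 -> I q l2 -> l1 = l2.
Proof. by case: gq => _ _ + _; apply. Qed.

Lemma point_unique p q l1 l2 :
  l1 != l2 -> I p l1 -> I q l1 -> I p l2 -> I q l2 -> p = q.
Proof.
move=> nl p1 q1 p2 q2; apply/eqP; apply: contraNT nl => npq.
by apply/eqP; apply: line_unique npq p1 q1 p2 q2.
Qed.

Lemma collinearI p q l : I p l -> I q l -> col p q.
Proof. by move=> pl ql; apply/existsP; exists l; rewrite pl. Qed.

Lemma collinear_sym p q : col p q = col q p.
Proof. by apply: eq_existsb => l; rewrite andbC. Qed.

Lemma pencil_nonempty p : exists l, I p l.
Proof.
have /card_gt0P[l] : 0 < #|[set l | I p l]| by rewrite card_pencil.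
by rewrite inE; exists l.
Qed.

Lemma collinear_refl p : col p p.
Proof. by have [l pl] := pencil_nonempty p; exact: (collinearI pl pl). Qed.

Lemma no_triangle p l q r :
  I q l -> I r l -> q != r -> col p q -> col p r -> I p l.
Proof.
move=> ql rl nqr pq pr; apply: contraNT nqr => npl.
case: gq => _ _ _ /(_ p l npl)[z [_ zP]]; apply/eqP.
by rewrite -(zP q) ?ql // -(zP r) ?rl.
Qed.

Lemma point_off_line p l q r :
  ~~ I p l -> I q l -> I r l -> col p q -> col p r -> q = r.
Proof.
move=> npl ql rl pq pr; apply/eqP; apply: contraNT npl => nqr.
exact: no_triangle nqr pq pr.
Qed.

(* Meaningful only when p is not on l. *)
Definition proj p l : P := odflt p [pick q | I q l && col p q].

Lemma projP p l : ~~ I p l -> I (proj p l) l /\ col p (proj p l).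
Proof.
move=> npl; rewrite /proj; case: pickP => [q /andP[]|none] //.
by case: gq => _ _ _ /(_ p l npl)[z [/[!none]]].
Qed.

(** Projecting z to the lines through y is a bijection from the pencil of y to the perp. *)
Lemma card_perp2 y z : ~~ col y z -> #|perp I [set y; z]| = t.+1.
Proof.
move=> nyz; have nzl l : I y l -> ~~ I z l.
  by move=> yl; apply: contraNN nyz => zl; apply: collinearI yl zl.
rewrite -(card_pencil y) -(card_in_imset (f := proj z) (D := [set l | I y l])).
  congr #|pred_of_set _|; apply/setP=> p; rewrite inE; apply/forall_inP/imsetP.
    move=> pP; have /existsP[l /andP[yl pl]] : col y p by apply: pP; rewrite set21.
    exists l; rewrite ?inE //.
    have [ql zq] := projP (nzl _ yl); apply: (point_off_line (nzl _ yl)) => //.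
    by apply: pP; rewrite set22.
  case=> l /[!inE] yl -> q /set2P[->|->]; have [ql zq] := projP (nzl _ yl) => //.
  exact: collinearI ql.
move=> l1 l2 /[!inE] yl1 yl2 e.
have [q1 zq1] := projP (nzl _ yl1); have [q2 _] := projP (nzl _ yl2).
rewrite -e in q2; apply: line_unique yl1 q1 yl2 q2.
by apply: contraNneq nyz => ->; rewrite collinear_sym.
Qed.

(** * Concurrency of lines and counts of common neighbours *)

Definition meet (l m : L) : bool := (l != m) && [exists p, I p l && I p m].
Definition nbr (l : L) : {set L} := [set m | meet l m].

Lemma meetI p l m : l != m -> I p l -> I p m -> meet l m.
Proof. by move=> nlm pl pm; rewrite /meet nlm; apply/existsP; exists p; rewrite pl. Qed.

Lemma meetP l m : reflect (l <> m /\ exists2 p, I p l & I p m) (meet l m).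
Proof.
apply: (iffP andP) => [[/eqP nlm /existsP[p /andP[]]]|[/eqP nlm [p pl pm]]].
  by split=> //; exists p.
by split=> //; apply/existsP; exists p; rewrite pl.
Qed.

Lemma meet_sym l m : meet l m = meet m l.
Proof. by rewrite /meet eq_sym; congr andb; apply: eq_existsb => p; rewrite andbC. Qed.

Lemma meet_irr l : meet l l = false.
Proof. by rewrite /meet eqxx. Qed.

(** Each line of X meets u in exactly one point, so these points partition X. *)
Lemma card_meeting (X : {set L}) u :
  X \subset nbr u -> #|X| = \sum_(p | I p u) #|[set m in X | I p m]|.
Proof.
move=> /subsetP sX; transitivity (\sum_(m in X) \sum_(p | I p u) (I p m : nat)).
  rewrite -sum1_card; apply: eq_bigr => m /sX /[!inE] /meetP[/eqP num [p pu pm]].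
  rewrite (bigD1 p) //= pm big1 // => q /andP[qu nqp].
  by case: (boolP (I q m)) => // qm; rewrite (point_unique num qu pu qm pm) eqxx in nqp.
rewrite exchange_big; apply: eq_bigr => p _.
by rewrite -sum1dep_card -big_mkcondr.
Qed.

Lemma sum_line u n : \sum_(p | I p u) n = s.+1 * n.
Proof. by rewrite sum_nat_const -(card_line u) cardsE. Qed.

Lemma card_nbr u : #|nbr u| = s.+1 * t.
Proof.
rewrite (card_meeting (subxx _)) -(sum_line u); apply: eq_bigr => p pu.
have -> : [set m in nbr u | I p m] = [set m | I p m] :\ u.
  apply/setP=> m; rewrite !inE; case: (boolP (I p m)) => pm; rewrite ?andbF // !andbT.
  by rewrite eq_sym; apply/idP/idP => [/andP[]|num] //; apply: meetI pm.
by have := cardsD1 u [set m | I p m]; rewrite card_pencil inE pu => -[].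
Qed.

(** The only candidate joins p to its projection on v. *)
Lemma card_transversal_through u v p :
  u != v -> ~~ meet u v -> I p u -> #|[set m in nbr u :&: nbr v | I p m]| = 1.
Proof.
move=> nuv nmuv pu.
have npv : ~~ I p v by apply: contraNN nmuv; apply: meetI pu.
have [qv pq] := projP npv; case/existsP: (pq) => l /andP[pl ql].
have nul : u != l by apply: contraNneq nmuv => ul; rewrite -ul in ql; apply: meetI ql qv.
have nvl : v != l by apply: contraNneq npv => ->.
apply/eqP/cards1P; exists l; apply/setP=> m; rewrite !inE.
apply/andP/eqP => [[/andP[_ /meetP[_ [r rv rm]]] pm]|->]; last first.
  by rewrite (meetI nul pu pl) (meetI nvl qv ql).
have rq : r = proj p v by apply: (point_off_line npv) => //; apply: collinearI pm rm.
apply: (@line_unique p r) => //; last by rewrite rq.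
by apply: contraNneq npv => ->.
Qed.

Lemma card_nbrI_disjoint u v :
  u != v -> ~~ meet u v -> #|nbr u :&: nbr v| = s.+1.
Proof.
move=> nuv nmuv; rewrite (card_meeting (subsetIl _ _)) -[RHS]muln1 -(sum_line u).
by apply: eq_bigr => p; apply: card_transversal_through.
Qed.

(** A line meeting u and v away from o would close a triangle. *)
Lemma nbrI_meet u v o :
  u != v -> I o u -> I o v -> nbr u :&: nbr v = [set m | I o m] :\ u :\ v.
Proof.
move=> nuv ou ov; apply/setP=> m; rewrite !inE.
apply/andP/and3P => [[]|[nmv nmu om]]; last first.
  by split; apply: meetI om; rewrite // eq_sym.
move=> /meetP[/eqP num [p pu pm]] /meetP[/eqP nvm [q qv qm]].
split; try by rewrite eq_sym.
have [-> //|noq] := eqVneq o q.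
have pv : I p v.
  exact: (no_triangle ov qv noq (collinearI pu ou) (collinearI pm qm)).
by rewrite (point_unique nuv ou pu ov pv).
Qed.

Lemma card_nbrI_meet u v : meet u v -> #|nbr u :&: nbr v| = t.-1.
Proof.
case/meetP=> /eqP nuv [o ou ov]; rewrite (nbrI_meet nuv ou ov).
have := cardsD1 u [set m | I o m]; rewrite card_pencil inE ou => -[->].
by rewrite (cardsD1 v ([set m | I o m] :\ u)) !inE ov eq_sym nuv.
Qed.

(** * Double counting: first and second moments of the number of lines of a set met by a line *)

Lemma card_setI_nbr (X : {set L}) w : #|X :&: nbr w| = \sum_(m in X) (meet m w : nat).
Proof.
rewrite -sum1_card (eq_bigl (fun m => (m \in X) && meet m w)); last first.
  by move=> m; rewrite !inE meet_sym.
by rewrite big_mkcondr.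
Qed.

Lemma sum_setI_nbr (X : {set L}) :
  \sum_w #|X :&: nbr w| = \sum_(m in X) #|nbr m|.
Proof.
under eq_bigr do rewrite card_setI_nbr.
rewrite exchange_big; apply: eq_bigr => m _.
by rewrite -sum1dep_card [RHS]big_mkcond.
Qed.

Lemma sum_setI_nbr_sqr (X : {set L}) :
  \sum_w #|X :&: nbr w| ^ 2 = \sum_(m in X) \sum_(n in X) #|nbr m :&: nbr n|.
Proof.
under eq_bigr do rewrite -mulnn card_setI_nbr big_distrlr /=.
rewrite exchange_big; apply: eq_bigr => m _.
rewrite exchange_big; apply: eq_bigr => n _.
rewrite -sum1_card [RHS]big_mkcond; apply: eq_bigr => w _.
by rewrite !inE; case: meet => //; case: meet.
Qed.

Definition disj (l : L) : {set L} := [set m | (m != l) && ~~ meet l m].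

Lemma sum_lines u (F : L -> nat) :
  \sum_w F w = F u + \sum_(w in nbr u) F w + \sum_(w in disj u) F w.
Proof.
rewrite (bigD1 u) //= -addnA; congr addn; rewrite (bigID (mem (nbr u))) /=.
congr addn; apply: eq_bigl => w; rewrite !inE //.
by apply/andP/idP => [[]|/meetP[/eqP nuw [p pu pw]]] //; rewrite eq_sym nuw (meetI nuw pu pw).
Qed.

(** Pairs (m, w) of concurrent lines with m in [nbr u] are counted twice. Sorting by w, the line u
    contributes [#|nbr u|], each neighbour of u contributes t - 1, and each line disjoint from u
    contributes s + 1. *)
Lemma card_disj u : #|disj u| = s * t ^ 2.
Proof.
have /eqP := sum_setI_nbr (nbr u).
under [X in _ == X]eq_bigr do rewrite card_nbr.
rewrite sum_nat_const card_nbr (sum_lines u) setIid card_nbr.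
rewrite (eq_bigr (fun=> t.-1)); last by move=> w /[!inE]; apply: card_nbrI_meet.
rewrite [X in _ + _ + X](eq_bigr (fun=> s.+1)); last first.
  by move=> w /[!inE] /andP[nwu nmuw]; rewrite card_nbrI_disjoint // eq_sym.
rewrite !sum_nat_const card_nbr => /eqP e.
(* The truncated [t.-1] is t - 1 only for positive t. *)
have [t0|t1] := posnP t; first by rewrite t0 in e *; nia.
have : s.+1 * #|disj u| = s.+1 * (s * t ^ 2).
  by move: e; rewrite -{4}(prednK t1); move: (t.-1) (prednK t1) => t'; nia.
by move/eqP; rewrite eqn_pmul2l // => /eqP.
Qed.

(** * Transversals of two disjoint lines, and of three *)

Section Triads.
Variables u v : L.
Hypotheses (nuv : u != v) (nmuv : ~~ meet u v).
Let C := nbr u :&: nbr v.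

Lemma sum_lines2 (F : L -> nat) :
  \sum_w F w = F u + F v + \sum_(w in C) F w + \sum_(w in nbr u :\: nbr v) F w
    + \sum_(w in nbr v :\: nbr u) F w + \sum_(w in disj u :&: disj v) F w.
Proof.
rewrite (sum_lines u) (big_setID (nbr v)) /=.
rewrite (bigD1 v (P := mem (disj u))) /=; last by rewrite inE eq_sym nuv.
rewrite (bigID (mem (nbr v)) (fun w => (w \in disj u) && (w != v))) /=.
rewrite [X in _ + (_ + (X + _))](eq_bigl (fun w => w \in nbr v :\: nbr u)); last first.
  move=> w; rewrite !inE; have [->|nwu] := eqVneq w u.
    by rewrite [meet v u]meet_sym (negPf nmuv) !andbF.
  by have [->|nwv] := eqVneq w v; rewrite ?meet_irr /= ?andbF ?andbT.
rewrite [X in _ + (_ + (_ + X))](eq_bigl (fun w => w \in disj u :&: disj v)); last first.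
  by move=> w; rewrite !inE -andbA.
by rewrite -/C; lia.
Qed.

(** With no triangles, a transversal that meets w must do so at p, where w meets u. *)
Lemma transversalsI_nbr w p :
  u != w -> I p u -> I p w -> C :&: nbr w = [set m in C | I p m] :\ w.
Proof.
move=> nuw pu pw; apply/setP=> m; have := nbrI_meet nuw pu pw.
move/setP/(_ m); rewrite !inE; case: (boolP (meet u m)) => /= [/andP[num _] ->|_ _].
  by rewrite [m == u]eq_sym num /= andbCA.
by rewrite andbF.
Qed.

(** Exactly one transversal passes through the common point of u and w; it is w itself, hence not
    counted, precisely when w meets v. *)
Lemma card_transversals_meeting w : w \in nbr u -> #|C :&: nbr w| = ~~ meet v w.
Proof.
rewrite inE => /[dup] muw /meetP[/eqP nuw [p pu pw]].
rewrite (transversalsI_nbr nuw pu pw).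
have := cardsD1 w [set m in C | I p m].
by rewrite (card_transversal_through nuv nmuv pu) !inE pw muw andbT; case: meet => /=; lia.
Qed.

End Triads.

Lemma card_disj2 u v : u != v -> ~~ meet u v ->
  #|disj u :&: disj v| + s * t + t = s * t ^ 2 + s.
Proof.
move=> nuv nmuv; have := sum_lines2 nuv nmuv (fun=> 1).
rewrite (sum_lines u) !sum1_card card_disj card_nbr (card_nbrI_disjoint nuv nmuv).
have := cardsID (nbr v) (nbr u); have := cardsID (nbr u) (nbr v).
rewrite [nbr v :&: _]setIC (card_nbrI_disjoint nuv nmuv) !card_nbr; nia.
Qed.

(* The number of transversals meeting a line disjoint from both u and v has
   mean t + 1 and, when s = t ^ 2, variance zero. *)
Lemma card_triad_transversals u v w : s = t ^ 2 ->
  u != v -> ~~ meet u v -> w \in disj u :&: disj v ->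
  #|nbr u :&: nbr v :&: nbr w| = t.+1.
Proof.
move=> st nuv nmuv wF; set C := nbr u :&: nbr v; pose c l := #|C :&: nbr l|.
pose F := disj u :&: disj v.
have cC : #|C| = s.+1 by apply: card_nbrI_disjoint.
have nvu : v != u by rewrite eq_sym.
have nmvu : ~~ meet v u by rewrite meet_sym.
have cu : c u = s.+1 by rewrite /c (setIidPl _) ?subsetIl.
have cv : c v = s.+1 by rewrite /c (setIidPl _) ?subsetIr.
have c0 l : l \in C -> c l = 0.
  case/setIP => lu lv; rewrite /c card_transversals_meeting //.
  by move: lv; rewrite inE => ->.
have c1 l : l \in nbr u :\: nbr v -> c l = 1.
  case/setDP => lu lv; rewrite /c card_transversals_meeting //.
  by move: lv; rewrite inE => ->.
have c1' l : l \in nbr v :\: nbr u -> c l = 1.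
  case/setDP => lu lv; rewrite /c /C setIC [nbr u :&: _]setIC setIC.
  by rewrite card_transversals_meeting //; move: lv; rewrite inE => ->.
have cuv : #|nbr u :\: nbr v| + s.+1 = s.+1 * t.
  by rewrite -[X in _ + X]cC addnC cardsID card_nbr.
have cvu : #|nbr v :\: nbr u| + s.+1 = s.+1 * t.
  by rewrite -[X in _ + X]cC addnC /C setIC cardsID card_nbr.
(* One formula serves both moments. Positivity of e makes the lines of [C], where [c] vanishes,
   contribute 0. *)
have sumC (e : nat) : 0 < e ->
    \sum_l c l ^ e + 2 * s.+1 = 2 * s.+1 ^ e + 2 * (s.+1 * t) + \sum_(l in F) c l ^ e.
  move=> e0; rewrite (sum_lines2 nuv nmuv) -/C cu cv big1; last first.
    by move=> l /c0->; rewrite exp0n.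
  rewrite (eq_bigr (fun=> 1)); last by move=> l /c1->; rewrite exp1n.
  rewrite [\sum_(_ in nbr v :\: _) _](eq_bigr (fun=> 1)); last first.
    by move=> l /c1'->; rewrite exp1n.
  by rewrite !sum1_card -/F; lia.
have S1 : \sum_l c l ^ 1 = s.+1 * (s.+1 * t).
  under eq_bigr do rewrite expn1.
  rewrite sum_setI_nbr; under eq_bigr do rewrite card_nbr.
  by rewrite sum_nat_const cC.
have S2 : \sum_l c l ^ 2 = s.+1 * (s.+1 * t + s * s.+1).
  rewrite sum_setI_nbr_sqr -cC -sum_nat_const; apply: eq_bigr => m mC.
  rewrite (bigD1 m) //= setIid card_nbr cC; congr addn.
  rewrite (eq_bigr (fun=> s.+1)).
    rewrite sum_nat_const; congr muln.
    have := cardsD1 m C; rewrite mC cC add1n => -[->]; apply: eq_card => l.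
    by rewrite in_setD1 andbC.
  (* Distinct transversals m and n are disjoint because [c m] is 0, so they have s + 1 common
     neighbours. *)
  move=> n /andP[nC nm]; apply: card_nbrI_disjoint; first by rewrite eq_sym.
  have := c0 _ mC; move/eqP; rewrite cards_eq0 => /eqP/setP/(_ n).
  by rewrite inE nC !inE /= => ->.
have F1 := sumC 1 isT; have F2 := sumC 2 isT; rewrite {}S1 {}S2 in F1 F2.
have dF := card_disj2 nuv nmuv; rewrite -/F in dF.
rewrite (eq_bigr c (fun l _ => expn1 (c l))) in F1.
(* Zero variance is expressed through 2ab <= a^2 + b^2 with b = t + 1: equality of the sums over [F]
   forces equality in every term. *)
have [_ eqF] : \sum_(l in F) 2 * (c l * t.+1) <= \sum_(l in F) (c l ^ 2 + t.+1 ^ 2)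
          ?= iff [forall (l | l \in F), c l == t.+1].
  by apply: leqif_sum => l _; apply: nat_Cauchy.
suff /eqP : \sum_(l in F) 2 * (c l * t.+1) = \sum_(l in F) (c l ^ 2 + t.+1 ^ 2).
  by rewrite eqF => /forall_inP/(_ w wF)/eqP.
rewrite -big_distrr -big_distrl /= big_split /= sum_nat_const.
move: F1 F2 dF; rewrite st; move: #|F| (\sum_(l in F) c l) (\sum_(l in F) c l ^ 2).
move=> f a b; nia.
Qed.

Lemma in_perp2 y z p : (p \in perp I [set y; z]) = col y p && col z p.
Proof.
rewrite inE; apply/forall_inP/andP => [pP|[yp zp] q /set2P[]->] //.
by split; apply: pP; rewrite ?set21 ?set22.
Qed.

Lemma other_line p l : 0 < t -> exists2 m, I p m & m != l.
Proof.
move=> t0; have := @exists_other _ [set m | I p m] l.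
by rewrite card_pencil ltnS => /(_ t0)[m] /[!inE] pm nml; exists m.
Qed.

Lemma other_point p l : 0 < s -> exists2 q, I q l & q != p.
Proof.
move=> s0; have := @exists_other _ [set q | I q l] p.
by rewrite card_line ltnS => /(_ s0)[q] /[!inE] ql nqp; exists q.
Qed.

End GeneralizedQuadrangle.

Lemma collineation_collinear (P L : finType) (I : P -> L -> bool) (g : {perm P}) p q :
  is_collineation I g -> collinear I p q -> collinear I (g p) (g q).
Proof.
case=> h gh /existsP[l /andP[pl ql]]; apply/existsP; exists (h l).
by rewrite !gh pl.
Qed.

(** * Elations about x *)

Section Elation.
Variables (P L : finType) (I : P -> L -> bool) (t : nat) (x : P).
Variable H : {group {perm P}}.
Hypotheses (t_gt0 : 0 < t) (gq : is_GQ I (t ^ 2) t) (egq : is_EGQ I x H).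
Notation col := (collinear I).

Let s_gt0 : 0 < t ^ 2. Proof. by rewrite expn_gt0 t_gt0. Qed.
Let H_collineation g : g \in H -> is_collineation I g. Proof. by case: egq => + _ _; apply. Qed.
Let H_line g l p : g \in H -> I x l -> I p l -> I (g p) l.
Proof. by case: egq => _ + _; apply. Qed.

Lemma elation_inj g h y : g \in H -> h \in H -> ~~ col x y -> g y = h y -> g = h.
Proof.
move=> gH hH nxy ghy.
have nxg : ~~ col x (g y).
  apply: contraNN nxy => /existsP[l /andP[xl gyl]]; apply/existsP; exists l.
  by rewrite xl -[y](permK g) H_line ?groupV.
case: egq => _ _ /(_ y (g y) nxy nxg)[k [_ kP]].
by rewrite -(kP g) // -(kP h).
Qed.

(** * A nontrivial elation fixing two lines through x pointwise is a symmetry *)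

Section TwoFixedLines.
Variables (g : {perm P}) (l1 l2 : L).
Hypotheses (gH : g \in H) (g_neq1 : g != 1%g) (nl12 : l1 != l2).
Hypotheses (xl1 : I x l1) (xl2 : I x l2).
Hypotheses (fix1 : forall p, I p l1 -> g p = p) (fix2 : forall p, I p l2 -> g p = p).

(* A point of l2 projects to a fixed point of a fixed line, and that point is
   not collinear with x. *)
Lemma no_fixed_transversal p m :
  I p l1 -> p != x -> I p m -> m != l1 -> ~ (forall q, I q m -> I (g q) m).
Proof.
move=> pl1 npx pm nml1 gm.
have nxm : ~~ I x m.
  by apply: contraNN nml1 => xm; apply/eqP/(line_unique gq npx).
have npm q : I q m -> col x q -> q = p.
  by move=> qm xq; apply: (point_off_line gq nxm) => //; apply: collinearI xl1 pl1.
have [q ql2 nqx] := other_point gq x l2 s_gt0.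
have nql1 : ~~ I q l1.
  by apply: contraNN nqx => ql1; apply/eqP; apply: (point_unique gq nl12).
have nqm : ~~ I q m.
  apply: contraNN nql1 => qm; rewrite (npm q) //.
  exact: collinearI xl2 ql2.
have [rm qr] := projP gq nqm; set r := proj I q m in rm qr.
have gr : g r = r.
  apply: (point_off_line gq nqm) => //; first exact: gm.
  by rewrite -(fix2 ql2); apply: collineation_collinear => //; apply: H_collineation.
(* The only point of m collinear with x is p. If r were p, then q would be collinear with two points
   of [l1] and so lie on it. *)
have nxr : ~~ col x r.
  apply: contraNN nql1 => xr; rewrite (npm r) // in qr.
  exact: (no_triangle gq pl1 xl1 npx qr (collinearI ql2 xl2)).
by case/eqP: g_neq1; apply: (elation_inj gH (group1 H) nxr); rewrite perm1.
Qed.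

Lemma fixes_perp w : col x w -> g w = w.
Proof.
case/existsP=> k /andP[xk wk]; apply/eqP/negPn/negP => ngw.
have gx : g x = x by apply: fix1.
have nwx : w != x by apply: contraNneq ngw => ->; rewrite gx.
have ngwx : g w != x by apply: contraNneq nwx => gwx; rewrite -(inj_eq (@perm_inj _ g)) gwx gx.
have nwl1 : ~~ I w l1 by apply: contraNN ngw => /fix1->.
have nkl1 : k != l1 by apply: contraNneq nwl1 => <-.
have gwk : I (g w) k by apply: H_line.
have [h gh] := H_collineation gH.
have [u wu nuk] := other_line gq w k t_gt0; pose v := h u.
have gwv : I (g w) v by rewrite gh.
have nxu : ~~ I x u.
  by apply: contraNN nuk => xu; apply/eqP/(line_unique gq nwx).
have nxv : ~~ I x v by rewrite -gx gh.
have nvk : v != k by apply: contraNneq nxv => ->.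
have nuv : u != v.
  apply: contraNneq nuk => uv; rewrite -uv in gwv.
  by apply/eqP/(line_unique gq ngw).
(* A common point r of u and v is collinear with w and [g w], so it lies on k; being on u and on v,
   it equals both w and [g w]. *)
have nmuv : ~~ meet I u v.
  apply: (contraNN _ ngw) => /meetP[_ [r ru rv]].
  have rk : I r k.
    by apply: (no_triangle gq gwk wk ngw); [apply: collinearI gwv|apply: collinearI wu].
  by apply/eqP; rewrite -(point_unique gq nvk rv gwv rk gwk) (point_unique gq nuk ru wu rk wk).
(* Stated for a general line m in order to serve both u and v: a point common to m and [l1] would
   form a triangle with x and z. *)
have disjl1 m z : I z m -> I z k -> z != x -> ~~ I x m -> l1 \in disj I m.
  move=> zm zk nzx nxm; rewrite inE; apply/andP; split.
    by apply: contraNneq nxm => <-.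
  apply: contraNN nxm => /meetP[_ [q qm ql1]].
  have qk : I q k.
    by apply: (no_triangle gq zk xk nzx); [apply: collinearI qm zm|apply: collinearI ql1 xl1].
  by rewrite -(point_unique gq nkl1 qk xk ql1 xl1).
have du := disjl1 u w wu wk nwx nxu.
have dv := disjl1 v (g w) gwv gwk ngwx nxv.
have := card_triad_transversals gq erefl nuv nmuv (w := l1).
rewrite inE du dv => /(_ isT) cT.
(* The line k is itself a transversal, through w, [g w] and x, so a different one is chosen. *)
have := @exists_other _ (nbr I u :&: nbr I v :&: nbr I l1) k.
rewrite cT ltnS => /(_ t_gt0)[m] /[!inE] /andP[/andP[]] + + + nmk.
move=> /meetP[_ [q qu qm]] /meetP[_ [q' q'v q'm]] /meetP[/eqP nl1m [p pl1 pm]].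
(* The only point of u collinear with x is w, so a transversal through x would be k. *)
have npx : p != x.
  apply: contraNneq nmk => px; rewrite px in pm.
  have qw : q = w.
    by apply: (point_off_line gq nxu) => //; [apply: collinearI qm|apply: collinearI wk].
  by rewrite qw in qm; apply/eqP/(line_unique gq nwx).
have npv : ~~ I p v.
  move: dv; rewrite inE => /andP[nl1v]; apply: contraNN => pv.
  by apply: meetI pl1 => //; rewrite eq_sym.
(* Both points are the projection of the fixed point p to v, so g maps the line pq to pq', which is
   again m. *)
have q'E : g q = q'.
  apply: (point_off_line gq npv) => //; first by rewrite gh.
    rewrite -(fix1 pl1); apply: collineation_collinear; first exact: H_collineation.
    exact: collinearI qm.
  exact: collinearI q'm.
have hm : h m = m.
  apply: (@line_unique _ _ _ _ _ gq p q') => //.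
  - by apply: contraNneq npv => ->.
  - by rewrite -(fix1 pl1) gh.
  - by rewrite -q'E gh.
apply: (no_fixed_transversal pl1 npx pm); first by rewrite eq_sym.
by move=> r rm; rewrite -hm gh.
Qed.

End TwoFixedLines.

Hypothesis star : propertyStar I x H.

(** * The stabilizer of two noncollinear points of the perp of x *)

Section Stabilizer.
Variables z1 z2 : P.
Hypotheses (nz12 : ~~ col z1 z2) (xz1 : col x z1) (xz2 : col x z2).

Definition stab2 : {group {perm P}} := 'C_H([set z1; z2] | 'P)%G.

Lemma stab2P g : reflect [/\ g \in H, g z1 = z1 & g z2 = z2] (g \in stab2).
Proof.
rewrite inE; apply: (iffP andP) => [[gH /astabP gfix]|[gH g1 g2]].
  by split=> //; apply: gfix; rewrite ?set21 ?set22.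
by split=> //; apply/astabP => z /set2P[]->.
Qed.

Lemma perp2_not_collinear y : y \in perp I [set z1; z2] :\ x -> ~~ col x y.
Proof.
rewrite in_setD1 in_perp2 => /and3P[nyx z1y z2y]; apply: contraNN nyx => xy.
have nz1x : z1 != x by apply: contraNneq nz12 => ->.
have nz2x : z2 != x by apply: contraNneq nz12 => ->; rewrite collinear_sym.
have [l1 /andP[xl1 z1l1]] := existsP xz1; have [l2 /andP[xl2 z2l2]] := existsP xz2.
have nl12 : l1 != l2 by apply: contraNneq nz12 => l12; apply: (collinearI z1l1); rewrite l12.
apply/eqP; apply: (point_unique gq nl12) => //.
  by apply: (no_triangle gq z1l1 xl1 nz1x); rewrite collinear_sym.
by apply: (no_triangle gq z2l2 xl2 nz2x); rewrite collinear_sym.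
Qed.

(** By [star], fixing [z1] and [z2] already fixes two lines through x pointwise. The identity is
    split off because [fixes_perp] needs a nontrivial element. *)
Lemma stab2_symmetry g : g \in stab2 -> symmetry_about I x g.
Proof.
case/stab2P=> gH g1 g2; split; first exact: H_collineation.
have [->|ng1] := eqVneq g 1%g; first by move=> p _; rewrite perm1.
have nz1x : z1 != x by apply: contraNneq nz12 => ->.
have nz2x : z2 != x by apply: contraNneq nz12 => ->; rewrite collinear_sym.
have [l1 /andP[xl1 z1l1]] := existsP xz1; have [l2 /andP[xl2 z2l2]] := existsP xz2.
have nl12 : l1 != l2 by apply: contraNneq nz12 => l12; apply: (collinearI z1l1); rewrite l12.
apply: (fixes_perp gH ng1 nl12 xl1 xl2).
  exact: (star nz1x xz1 gH g1 xl1 z1l1).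
exact: (star nz2x xz2 gH g2 xl2 z2l2).
Qed.

(** For transitivity, the elation taking y to y' automatically fixes [z1] and [z2]. *)
Lemma stab2_orbit y : y \in perp I [set z1; z2] :\ x ->
  [set g y | g : {perm P} in stab2] = perp I [set z1; z2] :\ x.
Proof.
move=> yP; have nxy := perp2_not_collinear yP.
move: (yP); rewrite in_setD1 in_perp2 => /and3P[nyx z1y z2y].
apply/setP=> y'; apply/imsetP/idP => [[g gS ->]|y'P].
  have [gcol gfix] := stab2_symmetry gS; case/stab2P: gS => gH g1 g2.
  rewrite in_setD1 in_perp2 -{1}g1 -{1}g2 !collineation_collinear // !andbT.
  apply: contraNneq nyx => gyx; rewrite -(inj_eq (@perm_inj _ g)) gyx eq_sym.
  by apply/eqP/gfix/(collinear_refl gq).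
have nxy' := perp2_not_collinear y'P.
move: y'P; rewrite in_setD1 in_perp2 => /and3P[_ z1y' z2y'].
case: egq => _ _ /(_ y y' nxy nxy')[g [[gH gy] _]]; exists g => //.
(* The elation preserves the line xz, so z and its image are both the projection of y' to that
   line. *)
have gfix z : col x z -> col z y -> col z y' -> g z = z.
  case/existsP=> l /andP[xl zl] zy zy'.
  have ny'l : ~~ I y' l by apply: contraNN nxy' => y'l; apply: collinearI y'l.
  apply: (point_off_line gq ny'l) => //; first exact: H_line.
    by rewrite collinear_sym -gy collineation_collinear //; apply: H_collineation.
  by rewrite collinear_sym.
by apply/stab2P; split=> //; apply: gfix.
Qed.

Lemma card_perp2_minus : #|perp I [set z1; z2] :\ x| = t.
Proof.
have := cardsD1 x (perp I [set z1; z2]); rewrite (card_perp2 gq nz12) in_perp2.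
by rewrite ![col _ x]collinear_sym xz1 xz2 => -[].
Qed.

(** By [elation_inj] the orbit map at y is injective, and its image has t points. *)
Lemma card_stab2 : #|stab2| = t.
Proof.
have /card_gt0P[y yP] : 0 < #|perp I [set z1; z2] :\ x| by rewrite card_perp2_minus.
rewrite -[RHS]card_perp2_minus -(stab2_orbit yP) card_in_imset // => g h.
move=> /stab2P[gH _ _] /stab2P[hH _ _].
exact: elation_inj gH hH (perp2_not_collinear yP).
Qed.

End Stabilizer.

(** * The group of t symmetries and the regularity of x *)

Lemma two_lines_through : exists l1 l2, [/\ l1 != l2, I x l1 & I x l2].
Proof.
have [l1 xl1] := pencil_nonempty gq x; have [l2 xl2 nl21] := other_line gq x l1 t_gt0.
by exists l1, l2; rewrite eq_sym.
Qed.

Lemma not_collinear_of_lines l1 l2 z1 z2 : l1 != l2 -> I x l1 -> I x l2 ->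
  I z1 l1 -> I z2 l2 -> z1 != x -> z2 != x -> ~~ col z1 z2.
Proof.
move=> nl12 xl1 xl2 z1l1 z2l2 nz1x nz2x; apply: contraNN nz1x => z12.
apply/eqP; apply: (point_unique gq nl12) => //.
exact: (no_triangle gq z2l2 xl2 nz2x z12 (collinearI z1l1 xl1)).
Qed.

Lemma egq_is_STGQ : is_STGQ I t x H.
Proof.
have [l1 [l2 [nl12 xl1 xl2]]] := two_lines_through.
have [z1 z1l1 nz1x] := other_point gq x l1 s_gt0.
have [z2 z2l2 nz2x] := other_point gq x l2 s_gt0.
have nz12 := not_collinear_of_lines nl12 xl1 xl2 z1l1 z2l2 nz1x nz2x.
have xz1 := collinearI xl1 z1l1; have xz2 := collinearI xl2 z2l2.
exists (stab2 z1 z2); split; first exact: subsetIl.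
  exact: card_stab2.
by move=> g; apply: stab2_symmetry.
Qed.

Lemma egq_regular_point : regular_point I t x.
Proof.
move=> y nxy; have [l1 [l2 [nl12 xl1 xl2]]] := two_lines_through.
have off l : I x l -> ~~ I y l.
  by move=> xl; apply: contraNN nxy => yl; apply: collinearI yl.
have [z1l1 yz1] := projP gq (off _ xl1); have [z2l2 yz2] := projP gq (off _ xl2).
move: (proj I y l1) (proj I y l2) z1l1 yz1 z2l2 yz2 => z1 z2 z1l1 yz1 z2l2 yz2.
have nz1x : z1 != x by apply: contraNneq nxy => <-; rewrite collinear_sym.
have nz2x : z2 != x by apply: contraNneq nxy => <-; rewrite collinear_sym.
have nz12 := not_collinear_of_lines nl12 xl1 xl2 z1l1 z2l2 nz1x nz2x.
have xz1 := collinearI xl1 z1l1; have xz2 := collinearI xl2 z2l2.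
have yP : y \in perp I [set z1; z2] :\ x.
  rewrite in_setD1 in_perp2 ![col _ y]collinear_sym yz1 yz2 !andbT.
  by apply: contraNneq nxy => ->; apply: (collinear_refl gq).
rewrite -(card_perp2 gq nz12); apply: eq_card => p.
(* One inclusion holds because [z1] and [z2] belong to the perp of x and y. *)
rewrite [RHS]in_perp2 inE; apply/forall_inP/idP => [pP|pz z].
  by rewrite !pP // in_perp2 ?xz1 ?xz2.
rewrite in_perp2 => /andP[xz yz]; have [->|npx] := eqVneq p x; first by rewrite collinear_sym.
have : p \in perp I [set z1; z2] :\ x by rewrite in_setD1 npx in_perp2.
(* Conversely, p is the image of y under a symmetry g, and g fixes z, so collinearity of y and z
   carries over to p and z. *)
rewrite -(stab2_orbit nz12 xz1 xz2 yP) => /imsetP[g gS ->].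
have [gcol gfix] := stab2_symmetry nz12 xz1 xz2 gS.
by rewrite -(gfix z xz) collineation_collinear // collinear_sym.
Qed.

End Elation.

Theorem mainTheorem4 (P L : finType) (I : P -> L -> bool) (t : nat) (x : P)
    (H : {group {perm P}}) :
  0 < t ->
  is_GQ I (t ^ 2) t ->
  is_EGQ I x H ->
  propertyStar I x H ->
  is_STGQ I t x H /\ regular_point I t x.
Proof.
move=> t0 gq egq star; split; first exact: egq_is_STGQ egq star.
exact: egq_regular_point egq star.
Qed.
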